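(* Let $n\geq 2$ be an integer and let $G\leq \operatorname{Homeo}([0,1])$ be any subgroup containing the Thompson group $F_n$ (in the case $n=2$, $F_2=F$ is Thompson's group $F$). Then the group Zariski topology $\mathfrak{Z}_G$ on $G$ is equal to the compact-open topology on $G$. In particular, $\mathfrak{Z}_G$ is a Hausdorff group topology on $G$.
   Context: A group topology on a group $G$ is a topology on the set $G$ for which multiplication $G\times G\to G$ and inversion $G\to G$ are continuous. The group Zariski topology $\mathfrak{Z}_G$ on a group $G$ with identity $1_G$ is the topology on $G$ with subbasis consisting of the sets $\{x\in G \mid 1_G\neq g_0x^{k_0}g_1\cdots g_{l-1}x^{k_{l-1}}g_l\}$, where $l\in\mathbb{N}=\{0,1,2,\ldots\}$, $g_0,\ldots,g_l\in G$ and $k_0,\ldots,k_{l-1}\in\mathbb{Z}$. $\operatorname{Homeo}([0,1])$ is the group of all homeomorphisms of $[0,1]$ under composition. The compact-open topology on $\operatorname{Homeo}(X)$ has subbasis the sets $\{f\in\operatorname{Homeo}(X)\mid f(K)\subseteq U\}$ with $K\subseteq X$ compact and $U\subseteq X$ open; a subgroup $G$ carries the subspace topology, also called the compact-open topology on $G$. The Thompson group $F_n$ is the group of orientation-preserving piecewise linear homeomorphisms of $[0,1]$ (with finitely many pieces) having all slopes in $\{n^k\mid k\in\mathbb{Z}\}$ and all breakpoints in $\mathbb{Z}[\frac1n]$. *)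

(* Defs.v *)
From HB Require Import structures.
From mathcomp Require Import all_boot all_order all_algebra.
From mathcomp Require Import all_classical reals topology normedtype.

Set Implicit Arguments.
Unset Strict Implicit.
Unset Printing Implicit Defensive.

Import Order.TTheory GRing.Theory Num.Theory.
Import numFieldNormedType.Exports.

Local Open Scope classical_set_scope.
Local Open Scope ring_scope.

#[short(type="groupTopologicalType")]
HB.structure Definition GroupTopological := {G of Group G & Topological G}.

(** The structures of a [groupTopologicalType] need not be compatible; this
    predicate says that they are. *)
Definition group_topology (G : groupTopologicalType) : Prop :=
  continuous (fun p : G * G => (p.1 * p.2)%g) /\
  continuous (fun x : G => (x^-1)%g).

Definition subgroup (G : groupType) (S : groupClosed G) : Type :=
  {x : G | x \in S}.

Section Subgroup.
Context (G : groupType) (S : groupClosed G).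
HB.instance Definition _ := [isSub of subgroup S for sval].
HB.instance Definition _ := [Choice of subgroup S by <:].

Lemma subgroup_group_closed : group_closed S.
Proof. by split=> [|x y xS yS]; [exact: gpred1 | exact: gpredF]. Qed.

HB.instance Definition _ :=
  SubChoice_isSubGroup.Build G _ (subgroup S) subgroup_group_closed.
End Subgroup.

Section Zariski.
Context (G : groupType).

Definition expgz (x : G) (k : int) : G :=
  match k with
  | Posz m => (x ^+ m)%g
  | Negz m => (x ^- m.+1)%g
  end.

(** [g 0 * x ^ k 0 * g 1 * ... * g (l - 1) * x ^ k (l - 1) * g l]; the values
    of [g] beyond [l] and of [k] beyond [l - 1] are not used. *)
Definition word_value (l : nat) (g : nat -> G) (k : nat -> int) (x : G) : G :=
  ((\prod_(i < l) (g i * expgz x (k i))) * g l)%g.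

Definition zariski_subbase : set_system G :=
  [set U | exists (l : nat) (g : nat -> G) (k : nat -> int),
     U = [set x | 1%g <> word_value l g k x]].

Definition zariski : Type := G.
HB.instance Definition _ := Group.on zariski.
HB.instance Definition _ :=
  isSubBaseTopological.Build zariski zariski_subbase id.

End Zariski.

Section Homeo.
Context (X : topologicalType).

Record homeo : Type := Homeo {
  homeo_fun :> X -> X;
  homeo_inv : X -> X;
  homeo_funK : cancel homeo_fun homeo_inv;
  homeo_invK : cancel homeo_inv homeo_fun;
  homeo_fun_continuous : continuous homeo_fun;
  homeo_inv_continuous : continuous homeo_inv
}.

Lemma homeoP (f g : homeo) : f =1 g -> f = g.
Proof.
case: f g => [f f' fK f'K cf cf'] [g g' gK g'K cg cg'] /= fg.
have {}fg : f = g by apply/funext.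
subst g.
have fg' : f' = g' by apply/funext => x; rewrite -{1}(g'K x) fK.
subst g'.
by congr Homeo; exact: Prop_irrelevance.
Qed.

HB.instance Definition _ := gen_eqMixin homeo.
HB.instance Definition _ := gen_choiceMixin homeo.

Definition homeo_id : homeo :=
  @Homeo idfun idfun (fun=> erefl) (fun=> erefl)
    (fun=> cvg_id) (fun=> cvg_id).

Definition homeo_comp (f g : homeo) : homeo :=
  @Homeo (f \o g) (homeo_inv g \o homeo_inv f)
    (can_comp (homeo_funK f) (homeo_funK g))
    (can_comp (homeo_invK g) (homeo_invK f))
    (fun x => continuous_comp (@homeo_fun_continuous g x)
                              (@homeo_fun_continuous f (g x)))
    (fun x => continuous_comp (@homeo_inv_continuous f x)
                              (@homeo_inv_continuous g (homeo_inv f x))).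

Definition homeo_sym (f : homeo) : homeo :=
  @Homeo (homeo_inv f) f (@homeo_invK f) (@homeo_funK f)
    (@homeo_inv_continuous f) (@homeo_fun_continuous f).

Lemma homeo_compA : associative homeo_comp.
Proof. by move=> f g h; apply: homeoP. Qed.

Lemma homeo_comp1h : left_id homeo_id homeo_comp.
Proof. by move=> f; apply: homeoP. Qed.

Lemma homeo_comph1 : right_id homeo_id homeo_comp.
Proof. by move=> f; apply: homeoP. Qed.

Lemma homeo_compVh : left_inverse homeo_id homeo_sym homeo_comp.
Proof. by move=> f; apply: homeoP => x /=; rewrite homeo_funK. Qed.

Lemma homeo_comphV : right_inverse homeo_id homeo_sym homeo_comp.
Proof. by move=> f; apply: homeoP => x /=; rewrite homeo_invK. Qed.

HB.instance Definition _ :=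
  isGroup.Build homeo homeo_compA homeo_comp1h homeo_comph1
    homeo_compVh homeo_comphV.

(** The compact-open topology, induced from that of [X -> X]; its subbasis is
    [[set f : homeo | f @` K `<=` U]] for [K] compact and [U] open. *)
HB.instance Definition _ := Topological.copy homeo
  (initial_topology (homeo_fun : homeo -> {compact-open, X -> X})).

End Homeo.

Definition compact_open_subgroup (X : topologicalType)
    (G : groupClosed (homeo X)) : Type :=
  initial_topology (val : subgroup G -> homeo X).
HB.instance Definition _ (X : topologicalType) (G : groupClosed (homeo X)) :=
  Topological.on (compact_open_subgroup G).

Section Thompson.
Context (R : realType).

Definition I01 : topologicalType := set_type `[0 : R, 1]%classic.

Context (n : nat).

(** Membership in [Z[1/n]]. *)
Definition in_Zinv (x : R) : Prop :=
  exists (a : int) (m : nat), x = a%:~R / n%:R ^+ m.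

(** [0 :: s] is a finite subdivision [0 = t_0 < ... < t_m = 1] of [[0, 1]] with
    points in [Z[1/n]] such that [f] is affine on each [[t_i, t_(i+1)]], with
    slope a power of [n]; the breakpoints of [f] are then among the [t_i]. *)
Definition thompson : set (homeo I01) := [set f |
  {homo (f : I01 -> I01) : x y / val x < val y} /\
  exists s : seq R,
    [/\ path <%R 0 s, last 0 s = 1, {in s, forall x, in_Zinv x}
      & forall i, (i < size s)%N ->
        exists (k : int) (c : R), forall x : I01,
          (0 :: s)`_i <= val x <= s`_i -> val (f x) = n%:R ^ k * val x + c]].

End Thompson.

(* Main.v *)
From HB Require Import structures.
Require Import Defs.
From mathcomp Require Import all_boot all_order all_algebra.
From mathcomp Require Import all_classical reals topology normedtype.
From mathcomp Require Import finmap realfun.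
From mathcomp Require Import ring lra.

(** Both topologies are compared through joint continuity of evaluation.  For
    a compact Hausdorff space X and a family [phi : T -> homeo X], continuity of
    [phi] for the compact-open topology is the same as continuity of
    [(t, x) |-> phi t x] on [T * X], and this property is stable under products
    and inverses of families.

    The Zariski topology is coarser than the compact-open one: a word in [x]
    with constants is again a jointly continuous family, and since X is
    Hausdorff the set of the parameters where such a family differs from the
    identity is open ([word_neq1_open]).

    The Zariski topology is finer: it has to be shown that evaluation is
    jointly continuous on [zariski G * [0, 1]].  For elements [g] and [h]
    of the Thompson group, the inequation [[x g x^-1, h] <> 1] is a Zariski open
    condition on [x].  It forces the support of [x g x^-1], which is the image
    by [x] of the support of [g], to meet the support of [h].  Conversely, if
    [f] maps a point of an open set [A] into an open set [B], then [g] supported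
    in [A] and [h] supported in [B] can be chosen such that the inequation holds
    at [f].  Therefore the condition that [f A] meets [B] is Zariski open
    ([zariski_locally_hitting]).  A homeomorphism of the interval is monotone,
    and these conditions tell whether it increases or decreases.  If it
    increases and takes a small value at some point to the right of [p], its
    values near [p] are at least as small; the other bounds are symmetric.  This
    gives joint continuity ([locally_hitting_continuous]).

    Once the two topologies agree, the group axioms and separation for the
    Zariski topology follow from joint continuity of evaluation. *)

Set Implicit Arguments.
Unset Strict Implicit.
Unset Printing Implicit Defensive.

Import Order.TTheory GRing.Theory Num.Theory.
Import numFieldNormedType.Exports.

Local Open Scope classical_set_scope.
Local Open Scope ring_scope.

(** * Families of homeomorphisms with jointly continuous evaluation *)

Section JointlyContinuous.
Context (X : topologicalType).

Definition jointly_continuous (T : topologicalType) (phi : T -> homeo X) :=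
  continuous (fun p : T * X => phi p.1 p.2).

Lemma jointly_continuous_comp (S T : topologicalType) (phi : T -> homeo X)
    (u : S -> T) :
  continuous u -> jointly_continuous phi -> jointly_continuous (phi \o u).
Proof.
move=> uc phic [s x].
apply: (@continuous_comp _ _ _ (fun q : S * X => (u q.1, q.2))
  (fun q : T * X => phi q.1 q.2)); last exact: phic.
apply: cvg_pair; last exact: cvg_snd.
by apply: (@continuous_comp _ _ _ fst u (s, x)); [exact: cvg_fst|exact: uc].
Qed.

Lemma jointly_continuous_cst (T : topologicalType) (h : homeo X) :
  jointly_continuous (fun _ : T => h).
Proof.
move=> [t x]; apply: (@continuous_comp _ _ _ snd h (t, x)).
  exact: cvg_snd.
exact: homeo_fun_continuous.
Qed.

Lemma homeo_snd_continuous (T : topologicalType) (h : homeo X) :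
  continuous (fun q : T * X => (q.1, h q.2)).
Proof.
move=> [t x]; apply: cvg_pair; first exact: cvg_fst.
exact: (@jointly_continuous_cst T h (t, x)).
Qed.

Lemma near_homeo_snd (T : topologicalType) (h : homeo X) (t : T) (x : X)
    (P : T * X -> Prop) :
  (\forall q \near (t, h x), P q) -> \forall q \near (t, x), P (q.1, h q.2).
Proof. exact: (@homeo_snd_continuous T h (t, x)). Qed.

Lemma jointly_continuousM (T : topologicalType) (phi psi : T -> homeo X) :
  jointly_continuous phi -> jointly_continuous psi ->
  jointly_continuous (fun t => phi t * psi t)%g.
Proof.
move=> phic psic [t x].
apply: (@continuous_comp _ _ _ (fun q : T * X => (q.1, psi q.1 q.2))
  (fun q : T * X => phi q.1 q.2)); last exact: phic.
by apply: cvg_pair; [exact: cvg_fst | exact: psic].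
Qed.

(** Let [phi t y = x] with [y] in an open set [O].  Since the complement of [O]
    is compact, no [phi s] with [s] near [t] sends a point outside [O] to a
    point near [x]; so preimages under [phi s] of points near [x] lie in [O]. *)
Lemma jointly_continuousV (T : topologicalType) (phi : T -> homeo X) :
  hausdorff_space X -> compact [set: X] ->
  jointly_continuous phi -> jointly_continuous (fun t => (phi t)^-1)%g.
Proof.
move=> hX cX phic [t x] /= U; rewrite nbhsE => -[O [oO Ox] OU].
apply: filterS (_ : nbhs (t, x)
  (fun q => ~` O `<=` [set y | phi q.1 y <> q.2])).
  move=> -[s z] /= sz; apply: OU; apply: contrapT => /sz /=; apply.
  exact: homeo_invK.
have cO : compact (~` O).
  by apply: (subclosed_compact _ cX) => //; exact: open_closedC.
have /compact_near_coveringP ncO := cO.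
apply: (ncO (T * X)%type (nbhs (t, x)) (fun q y => phi q.1 y <> q.2)) => y nOy.
have neq : phi t y != x.
  apply/eqP => e; apply: nOy; rewrite -e in Ox.
  by move: Ox; rewrite /= homeo_funK.
move: hX; rewrite open_hausdorff => /(_ _ _ neq) [[A B] /=].
move=> -[/set_mem Ay /set_mem Bx] [oA oB /eqP AB0].
have /phic [[P Q] /= [Pt Qy] PQ] : nbhs (phi (t, y).1 (t, y).2) A.
  exact: open_nbhs_nbhs.
exists (Q, P `*` B) => /=.
  split => //; exists (P, B) => //=; split => //.
  exact: open_nbhs_nbhs.
move=> [y' [s z]] /= [Qy' [Ps Bz]] e.
have := PQ (s, y') (conj Ps Qy'); rewrite /= e => Az.
by suff : set0 z by []; rewrite -AB0.
Qed.

(** Currying: this is how continuity into the compact-open topology is obtained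
    throughout. *)
Lemma jointly_continuous_continuous (T : topologicalType)
    (phi : T -> homeo X) : jointly_continuous phi -> continuous phi.
Proof.
move=> phic; apply/continuousP => _ [A oA <-].
have /continuousP : continuous (fun t => phi t : {compact-open, X -> X}).
  exact: (continuous_curry_fun phic).
exact.
Qed.

Lemma jointly_continuous_eval (T : topologicalType) (phi : T -> homeo X)
    (x : X) : jointly_continuous phi -> continuous (fun t => phi t x).
Proof.
move=> phic t.
apply: (@continuous_comp _ _ _ (fun s : T => (s, x)) (fun q => phi q.1 q.2)).
  by apply: cvg_pair; [exact: cvg_id|exact: cvg_cst].
exact: phic.
Qed.

(** Two homeomorphisms differ as soon as they differ at one point, which is an
    open condition. *)
Lemma jointly_continuous_neq_open (T : topologicalType) (phi : T -> homeo X)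
    (h : homeo X) : hausdorff_space X ->
  jointly_continuous phi -> open [set t | h <> phi t].
Proof.
move=> hX phic; rewrite (_ : [set _ | _] =
    \bigcup_x (fun t => phi t x) @^-1` (~` [set h x])); last first.
  apply/seteqP; split=> [t hphi|t [x _ /= hphi] e]; last by rewrite e in hphi.
  apply: contrapT => nex; apply: hphi; apply: homeoP => x.
  by apply: contrapT => hx; apply: nex; exists x => //= /esym.
apply: bigcup_open => x _; apply: open_comp.
  by move=> t _; exact: jointly_continuous_eval.
exact/closed_openC/accessible_closed_set1/hausdorff_accessible.
Qed.

Lemma jointly_continuous_inj_hausdorff (T : topologicalType)
    (phi : T -> homeo X) : hausdorff_space X ->
  injective phi -> jointly_continuous phi -> hausdorff_space T.
Proof.
move=> hX phi_inj phic s t st; apply/phi_inj/homeoP => x.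
apply: hX => A B sA tB.
have [u [Au Bu]] := st _ _ (jointly_continuous_eval phic sA)
  (jointly_continuous_eval phic tB).
by exists (phi u x).
Qed.

(** Uncurrying, the converse of [jointly_continuous_continuous], is where local
    compactness of the space enters. *)
Lemma homeo_jointly_continuous : hausdorff_space X -> compact [set: X] ->
  jointly_continuous (@idfun (homeo X)).
Proof.
move=> hX cX; pose ev (f : homeo X) : {compact-open, X -> X} := f.
rewrite /jointly_continuous (_ : (fun p => _) = uncurry ev); last first.
  by apply/funext => -[].
apply: continuous_uncurry.
- move=> x _; exists setT; first exact: filterT.
  by split => //; exact: closedT.
- by [].
- exact: initial_continuous.
- exact: homeo_fun_continuous.
Qed.

End JointlyContinuous.

(** * The unit interval and its homeomorphisms *)

Section UnitInterval.
Context (R : realType).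
Local Notation I := (I01 R).

Lemma val01P (x : I) : 0 <= val x <= 1.
Proof. by have := set_mem (valP x); rewrite /= in_itv /=. Qed.

Lemma mem01P (t : R) : 0 <= t <= 1 -> t \in `[0 : R, 1]%classic.
Proof. by move=> t01; apply: mem_set; rewrite /= in_itv. Qed.

Definition in01 (t : R) (t01 : 0 <= t <= 1) : I :=
  exist _ t (mem01P t01).

Lemma clamp01P (t : R) : 0 <= Num.max 0 (Num.min 1 t) <= 1.
Proof. by rewrite le_max lexx/= ge_max ler01 ge_min lexx. Qed.

(** A continuous retraction of the line onto the interval; composing with it
    turns self-maps of the interval into functions on the line. *)
Definition clamp01 (t : R) : I := in01 (clamp01P t).

Lemma clamp01K : cancel (val : I -> R) clamp01.
Proof.
move=> x; apply: val_inj => /=.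
have /andP[x0 x1] := val01P x.
by rewrite min_r// max_r.
Qed.

Lemma clamp01_id (t : R) : 0 <= t <= 1 -> val (clamp01 t) = t.
Proof. by move=> /andP[t0 t1] /=; rewrite min_r// max_r. Qed.

Lemma val01_continuous : continuous (val : I -> R).
Proof. exact: initial_continuous. Qed.

Lemma continuous01 (T : topologicalType) (f : T -> I) :
  continuous (fun t => val (f t)) -> continuous f.
Proof.
move=> /continuousP vfc; apply/continuousP => _ [A oA <-].
exact: vfc.
Qed.

Lemma clamp01_continuous : continuous clamp01.
Proof.
apply: continuous01 => t.
apply: (@continuous_max R R (cst 0) (cst 1 \min id) t); first exact: cvg_cst.
by apply: continuous_min; [exact: cvg_cst|exact: cvg_id].
Qed.

Lemma nbhs01P (x : I) (U : set I) :
  nbhs x U <->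
  exists2 e : R, 0 < e & forall y : I, `|val x - val y| < e -> U y.
Proof.
split=> [|[e e0 eU]]; last first.
  have := @val01_continuous x _ (nbhsx_ballx (val x) e e0).
  rewrite nbhs_simpl /=.
  apply: (@filterS _ (nbhs x) (nbhs_filter x)) => y /= xy.
  exact: eU.
rewrite nbhsE => -[_ [[A oA <-] /= Ax] AU].
have /nbhs_ballP[e /= e0 eA] : nbhs (val x) A by exact: open_nbhs_nbhs.
by exists e => // y xy; apply: AU; apply: eA.
Qed.

Lemma hausdorff01 : hausdorff_space I.
Proof.
move=> x y xy; apply: val_inj; apply: (@Rhausdorff R) => A B Ax By.
have [z [Az Bz]] := xy _ _ (val01_continuous Ax) (val01_continuous By).
by exists (val z).
Qed.

Lemma compact01 : compact [set: I].
Proof.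
rewrite (_ : [set: I] = clamp01 @` `[0, 1]%classic); last first.
  rewrite eqEsubset; split => x _ //=.
  by exists (val x); [exact: val01P|exact: clamp01K].
apply: continuous_compact; last exact: segment_compact.
exact/continuous_subspaceT/clamp01_continuous.
Qed.

Definition increasing (f : I -> I) := {homo f : x y / val x < val y}.
Definition decreasing (f : I -> I) := {homo f : x y /~ val x < val y}.

Lemma homeo01_monotone (f : homeo I) : increasing f \/ decreasing f.
Proof.
pose F (t : R) : R := val (f (clamp01 t)).
have Fc : {within `[0, 1], continuous F}.
  apply: continuous_subspaceT => t.
  apply: (@continuous_comp _ _ _ clamp01 (val \o f)).
    exact: clamp01_continuous.
  apply: continuous_comp; first exact: homeo_fun_continuous.
  exact: val01_continuous.
have Fi : {in `[0, 1] &, injective F}.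
  move=> s t; rewrite !in_itv /= => s01 t01 /val_inj /(can_inj (homeo_funK f)).
  by move=> /(congr1 val); rewrite !clamp01_id.
have [inc|dec] := itv_continuous_inj_mono Fc Fi.
- left=> x y xy; have := inc _ _ (val01P x) (val01P y) xy.
  by rewrite /F !clamp01K.
- right=> x y xy; have := dec _ _ (val01P x) (val01P y) xy.
  by rewrite /F !clamp01K.
Qed.

(** Thompson elements fix the endpoints, so the points at which they are used
    have to be moved off the boundary first. *)
Lemma exists_interior_near (x : I) (A : set I) : nbhs x A ->
  exists2 y, A y & 0 < val y < 1.
Proof.
move=> /nbhs01P[e e0 eA]; have /andP[x0 x1] := val01P x.
(* At most a quarter, so moving by [d] towards the middle stays inside. *)
pose d := Num.min e 2^-1 / 2.
have d0 : 0 < d by rewrite divr_gt0// lt_min e0/= invr_gt0.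
have de : d < e.
  rewrite ltr_pdivrMr// ; apply: le_lt_trans (_ : e < _); last by lra.
  by rewrite ge_min lexx.
have dh : d <= 4^-1.
  have : Num.min e 2^-1 <= 2^-1 by rewrite ge_min lexx orbT.
  by rewrite /d; lra.
have [xh|xh] := leP (val x) 2^-1.
- exists (clamp01 (val x + d)); last by rewrite clamp01_id; lra.
  apply: eA; rewrite clamp01_id; last by lra.
  by rewrite opprD addrA subrr sub0r normrN gtr0_norm.
- exists (clamp01 (val x - d)); last by rewrite clamp01_id; lra.
  apply: eA; rewrite clamp01_id; last by lra.
  by rewrite opprB addrC subrK gtr0_norm.
Qed.

(** By monotonicity the values at the endpoints bound the value at [x]
    strictly from both sides. *)
Lemma homeo01_interior (f : homeo I) (x : I) :
  0 < val x < 1 -> 0 < val (f x) < 1.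
Proof.
move=> /andP[x0 x1]; pose a : I := clamp01 0; pose b : I := clamp01 1.
have ax : val a < val x by rewrite clamp01_id// lexx ler01.
have xb : val x < val b by rewrite clamp01_id// lexx ler01.
have /andP[fa0 fa1] := val01P (f a); have /andP[fb0 fb1] := val01P (f b).
have [inc|dec] := homeo01_monotone f.
  by rewrite (le_lt_trans fa0 (inc _ _ ax)) (lt_le_trans (inc _ _ xb) fb1).
by rewrite (le_lt_trans fb0 (dec _ _ xb)) (lt_le_trans (dec _ _ ax) fa1).
Qed.

End UnitInterval.

(** * Monotone families determined by the open sets that their graphs meet *)

Section Hitting.
Context (R : realType).
Local Notation I := (I01 R).

Lemma nbhs_lt01 (x : I) (u : R) : val x < u -> nbhs x [set z : I | val z < u].
Proof.
move=> xu; apply/nbhs01P; exists (u - val x); first by rewrite subr_gt0.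
by move=> y /ltr_distlCDr; rewrite /= ; lra.
Qed.

Lemma nbhs_gt01 (x : I) (u : R) : u < val x -> nbhs x [set z : I | u < val z].
Proof.
move=> ux; apply/nbhs01P; exists (val x - u); first by rewrite subr_gt0.
by move=> y /ltr_distlDr; rewrite /=; lra.
Qed.

Lemma opp01P (x : I) : 0 <= 1 - val x <= 1.
Proof. by have := val01P x; lra. Qed.

Definition flip01_fun (x : I) : I := in01 (opp01P x).

Lemma flip01_funK : involutive flip01_fun.
Proof. by move=> x; apply: val_inj => /=; rewrite subKr. Qed.

Lemma flip01_fun_continuous : continuous flip01_fun.
Proof.
apply: continuous01 => x /=.
have := @continuousB R R I (cst 1) val x _ (@val01_continuous _ x).
by apply; exact: cst_continuous.
Qed.

(** Composing with the flip on the right reduces decreasing homeomorphisms to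
    increasing ones; composing on the left reduces lower bounds to upper
    bounds. *)
Definition flip01 : homeo I :=
  Homeo flip01_funK flip01_funK flip01_fun_continuous flip01_fun_continuous.

(** The graph of [phi t] lies in the lower limit of the graphs of [phi s]
    as [s] tends to [t]. *)
Definition locally_hitting (T : topologicalType) (phi : T -> homeo I) (t : T) :=
  forall (x : I) (A B : set I), nbhs x A -> nbhs (phi t x) B ->
    \forall s \near t, exists2 y, A y & B (phi s y).

Context (T : topologicalType).
Implicit Types (phi : T -> homeo I) (t : T).

Lemma locally_hittingMr phi t (h : homeo I) :
  locally_hitting phi t -> locally_hitting (fun s => phi s * h)%g t.
Proof.
move=> hit x A B xA phxB.
have hxA : nbhs (h x) (homeo_inv h @^-1` A).
  by apply: (@homeo_inv_continuous _ h (h x)); rewrite homeo_funK.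
apply: filterS (hit _ _ _ hxA phxB) => s [y Ay By].
by exists (homeo_inv h y) => //=; rewrite homeo_invK.
Qed.

Lemma locally_hittingMl phi t (h : homeo I) :
  locally_hitting phi t -> locally_hitting (fun s => h * phi s)%g t.
Proof.
move=> hit x A B xA hpxB.
have pxB : nbhs (phi t x) (h @^-1` B).
  exact: (@homeo_fun_continuous _ h (phi t x)) hpxB.
exact: hit xA pxB.
Qed.

Lemma near_fst t (x : I) (P : set T) :
  nbhs t P -> \forall q \near (t, x), P q.1.
Proof.
by move=> tP; exists (P, setT); [split => //; exact: filterT|move=> [? ?] []].
Qed.

Lemma near_snd t (x : I) (P : set I) :
  nbhs x P -> \forall q \near (t, x), P q.2.
Proof.
by move=> tP; exists (setT, P); [split => //; exact: filterT|move=> [? ?] []].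
Qed.

(** The graph of an increasing homeomorphism has a point to the lower left and a
    point to the upper right of the point over [1/2].  Nearby graphs have such
    points too, and this excludes decreasing maps. *)
Lemma locally_hitting_increasing phi t : locally_hitting phi t ->
  increasing (phi t) -> \forall s \near t, increasing (phi s).
Proof.
move=> hit inc.
pose c : I := clamp01 2^-1.
pose x : I := clamp01 4^-1; pose y : I := clamp01 (3 / 4).
have vc : val c = 2^-1 by rewrite clamp01_id//; lra.
have xc : val x < val c by rewrite vc clamp01_id//; lra.
have cy : val c < val y by rewrite vc clamp01_id//; lra.
have := hit _ _ _ (nbhs_lt01 xc) (nbhs_lt01 (inc _ _ xc)).
have := hit _ _ _ (nbhs_gt01 cy) (nbhs_gt01 (inc _ _ cy)).
apply: filterS2 => s [y' /= cy' pcy'] [x' /= xc' pxc'].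
have [//|dec] := homeo01_monotone (phi s).
have /dec := lt_trans xc' cy'.
by rewrite ltNge (ltW (lt_trans pxc' pcy')).
Qed.

(** A point [b > p] with [phi t b < u] exists unless [phi t p = 1].  Nearby maps
    take a value below [u] somewhere to the right of the midpoint [m] of [p]
    and [b], and being increasing they are below [u] on the left of [m]. *)
Lemma increasing_locally_hitting_lt phi t (p : I) (u : R) :
  locally_hitting phi t -> increasing (phi t) -> val (phi t p) < u ->
  \forall q \near (t, p), val (phi q.1 q.2) < u.
Proof.
move=> hit inc pu.
have [u1|u1] := ltP 1 u.
  by near=> q; apply: le_lt_trans u1; have /andP[] := val01P (phi q.1 q.2).
pose v : I := clamp01 ((val (phi t p) + u) / 2).
have vE : val v = (val (phi t p) + u) / 2.
  by rewrite clamp01_id//; have := val01P (phi t p); lra.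
pose b : I := homeo_inv (phi t) v.
have vb : phi t b = v by exact: homeo_invK.
have pb : val p < val b.
  rewrite ltNge le_eqVlt; apply/negP => /orP[/eqP/val_inj e|/inc].
    by move: vb vE => /[dup] e2; rewrite -e2 e; lra.
  by rewrite vb vE; lra.
pose m := (val p + val b) / 2.
have bm : m < val b by rewrite /m; lra.
have pm : val p < m by rewrite /m; lra.
have vu : val (phi t b) < u by rewrite vb vE; lra.
have near_inc := near_fst p (locally_hitting_increasing hit inc).
have near_xu := near_fst p (hit _ _ _ (nbhs_gt01 bm) (nbhs_lt01 vu)).
have near_m := near_snd t (nbhs_lt01 pm).
apply: filterS3 near_inc near_xu near_m => q /= qinc [x mx xu] qm.
by apply: lt_trans xu; apply: qinc; apply: lt_trans mx.
Unshelve. all: by end_near. Qed.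

Lemma locally_hitting_lt phi t (p : I) (u : R) :
  locally_hitting phi t -> val (phi t p) < u ->
  \forall q \near (t, p), val (phi q.1 q.2) < u.
Proof.
move=> hit pu; have [inc|dec] := homeo01_monotone (phi t).
  exact: increasing_locally_hitting_lt.
have pfu : val ((phi t * flip01)%g (flip01 p)) < u by rewrite /= flip01_funK.
have finc : increasing (phi t * flip01)%g.
  by move=> x y xy; apply: dec; rewrite /= ltrD2l ltrN2.
have near_pf :=
  increasing_locally_hitting_lt (locally_hittingMr (h := flip01) hit) finc pfu.
apply: filterS (near_homeo_snd near_pf) => -[s y] /=.
by rewrite flip01_funK.
Qed.

(** Lower bounds for [phi] are upper bounds for its composite with the flip. *)
Lemma locally_hitting_continuous phi t (p : I) : locally_hitting phi t ->
  {for (t, p), continuous (fun q : T * I => phi q.1 q.2)}.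
Proof.
move=> hit U /= /nbhs01P[e e0 eU].
have up : val (phi t p) < val (phi t p) + e by rewrite ltrDl.
have lo : val ((flip01 * phi t)%g p) < 1 - val (phi t p) + e.
  by rewrite /= ltrDl.
have := locally_hitting_lt hit up.
have := locally_hitting_lt (locally_hittingMl (h := flip01) hit) lo.
apply: filterS2 => q /= lq uq; apply: eU.
move: lq; rewrite -addrA ltrD2l ltrNl opprD opprK => lq.
by rewrite ltr_distlC lq.
Qed.

End Hitting.

(** * Piecewise linear maps supported in an interval *)

Section MaxMin.
Context (R : realDomainType).
Implicit Types f g : R -> R.

(** Increasing bijections form a lattice under pointwise maximum and minimum,
    and inversion exchanges the two operations.  Writing piecewise linear maps
    as lattice combinations of affine ones gives their inverses without any
    case analysis on pieces. *)
Lemma cancel_max f f' g g' :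
  {homo f' : x y / x <= y} -> {homo g' : x y / x <= y} ->
  cancel f f' -> cancel g g' -> cancel (f \max g) (f' \min g').
Proof.
move=> f'_nd g'_nd fK gK x /=; have [fg|gf] := leP (f x) (g x).
  by rewrite gK min_r// -[leLHS](fK x) f'_nd.
by rewrite fK min_l// -[leLHS](gK x) g'_nd// ltW.
Qed.

Lemma cancel_min f f' g g' :
  {homo f' : x y / x <= y} -> {homo g' : x y / x <= y} ->
  cancel f f' -> cancel g g' -> cancel (f \min g) (f' \max g').
Proof.
move=> f'_nd g'_nd fK gK x /=; have [fg|gf] := leP (f x) (g x).
  by rewrite fK max_l// -[leRHS](gK x) g'_nd.
by rewrite gK max_r// -[leRHS](fK x) f'_nd// ltW.
Qed.

Lemma homo_lt_max f g : {homo f : x y / x < y} -> {homo g : x y / x < y} ->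
  {homo f \max g : x y / x < y}.
Proof.
by move=> fi gi x y xy /=; rewrite gt_max !lt_max fi// gi// orbT.
Qed.

Lemma homo_lt_min f g : {homo f : x y / x < y} -> {homo g : x y / x < y} ->
  {homo f \min g : x y / x < y}.
Proof.
by move=> fi gi x y xy /=; rewrite lt_min !gt_min fi// gi// orbT.
Qed.

End MaxMin.

Section Bump.
Context (R : realType).
Local Notation I := (I01 R).

Lemma homeo01_of_real (f g : R -> R) :
    continuous f -> continuous g -> cancel f g -> cancel g f ->
    (forall t, 0 <= t <= 1 -> 0 <= f t <= 1) ->
    (forall t, 0 <= t <= 1 -> 0 <= g t <= 1) ->
  exists h : homeo I, forall x, val (h x) = f (val x).
Proof.
move=> fc gc fK gK f01 g01.
have lift_continuous (u : R -> R) : continuous u ->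
    continuous (fun x : I => clamp01 (u (val x))).
  move=> uc x.
  apply: (@continuous_comp I R I (fun y : I => u (val y)) (@clamp01 R) x).
    apply: (@continuous_comp I R R (fun y : I => val y) u x).
      exact: val01_continuous.
    exact: uc.
  exact: clamp01_continuous.
have liftK (u v : R -> R) : cancel u v ->
    (forall t, 0 <= t <= 1 -> 0 <= u t <= 1) ->
    cancel (fun x : I => clamp01 (u (val x)))
      (fun x : I => clamp01 (v (val x))).
  by move=> uK u01 x; rewrite clamp01_id ?u01 ?val01P// uK clamp01K.
exists (Homeo (liftK f g fK f01) (liftK g f gK g01)
  (lift_continuous f fc) (lift_continuous g gc)) => x.
by rewrite clamp01_id// f01// val01P.
Qed.

Definition dilation (c k t : R) : R := c + k * (t - c).

Lemma dilationE (c k t : R) : dilation c k t = t + (k - 1) * (t - c).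
Proof. by rewrite /dilation; ring. Qed.

Lemma dilationK (c k : R) : k != 0 -> cancel (dilation c k) (dilation c k^-1).
Proof.
by move=> k0 t; rewrite /dilation [c + k * _]addrC addrK mulKf// addrC subrK.
Qed.

Lemma dilationVK (c k : R) : k != 0 -> cancel (dilation c k^-1) (dilation c k).
Proof. by rewrite -invr_eq0 => /(dilationK c); rewrite invrK. Qed.

Lemma dilation_lt (c k : R) : 0 < k -> {homo dilation c k : s t / s < t}.
Proof. by move=> k0 s t st; rewrite ltrD2l ltr_pM2l// ltrD2r. Qed.

Lemma dilation_le (c k : R) : 0 < k -> {homo dilation c k : s t / s <= t}.
Proof. by move=> k0; exact/ltW_homo/dilation_lt. Qed.

Lemma dilation_continuous (c k : R) : continuous (dilation c k).
Proof.
move=> t; apply: cvgD; first exact: cvg_cst.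
by apply: cvgM; [exact: cvg_cst|apply: cvgB; [exact: cvg_id|exact: cvg_cst]].
Qed.

(** The graph over [a, b] is made of the line of slope [k] through [(a, a)] and
    the line of slope [1 / k] through [(b, b)], which lie above the diagonal
    there; outside [a, b] one of the two lies below it. *)
Definition hump (a b k : R) : R -> R :=
  id \max (dilation a k \min dilation b k^-1).

Definition hump_inv (a b k : R) : R -> R :=
  id \min (dilation a k^-1 \max dilation b k).

Section BumpTheory.
Context (a b k : R).
Hypothesis k1 : 1 < k.

Let k0 : 0 < k. Proof. exact: lt_trans k1. Qed.
Let kV0 : 0 < k^-1. Proof. by rewrite invr_gt0. Qed.
Let kV1 : k^-1 < 1. Proof. by rewrite invf_lt1. Qed.

Lemma humpK : cancel (hump a b k) (hump_inv a b k).
Proof.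
apply: cancel_max => //.
- by move=> s t st /=; rewrite ge_max !le_max !dilation_le// orbT.
- apply: cancel_min; try exact: dilation_le.
    exact/dilationK/lt0r_neq0.
  exact/dilationVK/lt0r_neq0.
Qed.

Lemma hump_invK : cancel (hump_inv a b k) (hump a b k).
Proof.
apply: cancel_min => //.
- by move=> s t st /=; rewrite le_min !ge_min !dilation_le// orbT.
- apply: cancel_max; try exact: dilation_le.
    exact/dilationVK/lt0r_neq0.
  exact/dilationK/lt0r_neq0.
Qed.

Lemma hump_lt : {homo hump a b k : s t / s < t}.
Proof. by apply: homo_lt_max => //; apply: homo_lt_min; exact: dilation_lt. Qed.

Lemma hump_continuous : continuous (hump a b k).
Proof.
move=> t; apply: (@continuous_max R R id); first exact: cvg_id.
by apply: (@continuous_min R R); exact: dilation_continuous.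
Qed.

Lemma hump_inv_continuous : continuous (hump_inv a b k).
Proof.
move=> t; apply: (@continuous_min R R id); first exact: cvg_id.
by apply: (@continuous_max R R); exact: dilation_continuous.
Qed.

Lemma hump_le_left t : t <= a -> hump a b k t = t.
Proof.
move=> ta; rewrite /hump /= max_l// ge_min; apply/orP; left.
by rewrite dilationE gerDl pmulr_rle0 ?subr_gt0// subr_le0.
Qed.

Lemma hump_ge_right t : b <= t -> hump a b k t = t.
Proof.
move=> bt; rewrite /hump /= max_l// ge_min; apply/orP; right.
by rewrite dilationE gerDl nmulr_rle0 ?subr_lt0// subr_ge0.
Qed.

Lemma hump_gt t : a < t < b -> t < hump a b k t.
Proof.
move=> /andP[at_ tb]; rewrite /hump /= lt_max lt_min; apply/orP; right.
rewrite !dilationE !ltrDl pmulr_rgt0 ?subr_gt0// at_/=.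
by rewrite nmulr_rgt0 ?subr_lt0.
Qed.

(** The value of [b] is the one for which the two lines meet over [a + d]. *)
Section Pieces.
Context (d : R).
Hypothesis bE : b = a + (k + 1) * d.

Let dilation_sub t :
  k * (dilation b k^-1 t - dilation a k t) = (k ^+ 2 - 1) * (a + d - t).
Proof. by rewrite /dilation bE; field; rewrite lt0r_neq0. Qed.

Let k21 : 0 < k ^+ 2 - 1. Proof. by rewrite subr_gt0 exprn_egt1. Qed.

Lemma hump_first_piece t : a <= t <= a + d -> hump a b k t = dilation a k t.
Proof.
move=> /andP[at_ td]; rewrite /hump /= min_l ?max_r//.
  by rewrite dilationE lerDl pmulr_rge0 ?subr_gt0// subr_ge0.
by rewrite -subr_ge0 -(pmulr_rge0 _ k0) dilation_sub pmulr_rge0// subr_ge0.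
Qed.

Lemma hump_second_piece t : a + d <= t <= b -> hump a b k t = dilation b k^-1 t.
Proof.
move=> /andP[dt tb]; rewrite /hump /= min_r ?max_r//.
  by rewrite dilationE lerDl nmulr_rge0 ?subr_lt0// subr_le0.
by rewrite -subr_le0 -(pmulr_rle0 _ k0) dilation_sub pmulr_rle0// subr_le0.
Qed.

End Pieces.

End BumpTheory.
End Bump.

(** * Elements of the Thompson group with small support *)

Section ThompsonBump.
Context (R : realType) (n : nat) (n_ge2 : (2 <= n)%N).
Local Notation I := (I01 R).

Let n1 : 1 < n%:R :> R. Proof. by rewrite ltr1n. Qed.
Let n0 : 0 < n%:R :> R. Proof. exact: lt_trans n1. Qed.

Lemma exists_small_power (e : R) : 0 < e -> exists m, n%:R / n%:R ^+ m < e.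
Proof.
move=> e0; pose m := (Num.trunc (n%:R / e)).+1; exists m.
rewrite ltr_pdivrMr ?exprn_gt0// mulrC -ltr_pdivrMr//.
apply: lt_trans (truncnS_gt _) _.
by rewrite -natrX ltr_nat ltn_expl.
Qed.

Lemma thompson_hump (a b d : R) (h : homeo I) :
    in_Zinv n a -> in_Zinv n (a + d) -> in_Zinv n b ->
    0 < a -> 0 < d -> b < 1 -> b = a + (n%:R + 1) * d ->
    (forall x, val (h x) = hump a b n%:R (val x)) -> thompson n h.
Proof.
move=> aZ adZ bZ a0 d0 b1 bE hE.
have adb : a + d < b by rewrite bE ltrD2l ltr_pMl// ltrDr.
have aad : a < a + d by rewrite ltrDl.
split; first by move=> x y xy; rewrite !hE; exact: hump_lt.
exists [:: a; a + d; b; 1]; split => //=.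
- by rewrite a0 aad adb b1.
- move=> x; rewrite !inE => /or4P[] /eqP-> //.
  by exists 1%Z, 0%N; rewrite expr0 divr1.
have first_affine t : a <= t <= a + d ->
    hump a b n%:R t = n%:R ^ 1%Z * t + (a - n%:R * a).
  by move=> ?; rewrite (hump_first_piece n1 bE)// /dilation expr1z; ring.
have second_affine t : a + d <= t <= b ->
    hump a b n%:R t = n%:R ^ (-1)%Z * t + (b - n%:R^-1 * b).
  by move=> ?; rewrite (hump_second_piece n1 bE)// /dilation exprN1; ring.
move=> [|[|[|[|//]]]] _.
- exists 0%Z, 0 => x /andP[_ xa].
  by rewrite hE hump_le_left// expr0z mul1r addr0.
- by exists 1%Z, (a - n%:R * a) => x xa; rewrite hE first_affine.
- by exists (-1)%Z, (b - n%:R^-1 * b) => x xa; rewrite hE second_affine.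
- exists 0%Z, 0 => x /andP[bx _].
  by rewrite hE hump_ge_right// expr0z mul1r addr0.
Qed.

(** A hump of slopes [n] and [1 / n] on the interval from [a] to
    [a + (n + 1) d], where [d] is a small power of [1 / n] and [a] a multiple
    of [d] just below [x]. *)
Lemma exists_thompson_supported (x : I) (A : set I) :
  0 < val x < 1 -> nbhs x A ->
  exists g : homeo I, [/\ thompson n g, g x <> x & forall z, ~ A z -> g z = z].
Proof.
move=> /andP[x0 x1] /nbhs01P[e e0 eA].
pose N : R := n%:R.
have [m] : exists m, N / N ^+ m < Num.min e (Num.min (val x) (1 - val x)).
  by apply: exists_small_power; rewrite !lt_min e0 x0 subr_gt0.
rewrite !lt_min => /and3P[me mx m1].
pose d : R := (N ^+ m)^-1.
have d0 : 0 < d by rewrite invr_gt0 exprn_gt0.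
(* One less than the floor, so that [a] is strictly below [x] even when [x] is
   a multiple of [d]. *)
pose j : int := (Num.floor (val x / d) - 1)%R.
pose a : R := j%:~R * d.
pose b : R := a + (N + 1) * d.
have aE : a = (Num.floor (val x / d))%:~R * d - d by rewrite /a rmorphB/=; ring.
have fl : (Num.floor (val x / d))%:~R * d <= val x.
  by rewrite -ler_pdivlMr// floor_le.
have fu : val x < (Num.floor (val x / d))%:~R * d + d.
  rewrite -[X in _ < _ + X]mul1r -mulrDl -ltr_pdivrMr//.
  by rewrite -[1]/(1%:~R) -rmorphD/= floorD1_gt.
have N2 : 2 * d <= N * d by rewrite ler_pM2r// (ler_nat R 2).
rewrite -/d in me mx m1.
have a0 : 0 < a by lra.
have bd : b = a + N * d + d by rewrite /b mulrDl mul1r addrA.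
have b1 : b < 1 by lra.
have ab : a < b by lra.
have fixed t : (t <= 0 -> hump a b N t = t) /\ (1 <= t -> hump a b N t = t).
  split=> tt; [apply: hump_le_left => // | apply: hump_ge_right => //].
  - exact: le_trans tt (ltW a0).
  - exact: le_trans (ltW b1) tt.
have Zk k : in_Zinv n (a + k%:R * d).
  exists (j + k%:Z)%R, m.
  by rewrite rmorphD/= mulrDl.
have b01 t : 0 <= t <= 1 -> 0 <= hump a b N t <= 1.
  have bl := ltW_homo (hump_lt a b n1).
  move=> /andP[/bl t0 /bl t1]; move: t0 t1.
  by rewrite (proj1 (fixed 0))// (proj2 (fixed 1))// => -> ->.
have bi01 t : 0 <= t <= 1 -> 0 <= hump_inv a b N t <= 1.
  have bm := le_mono (hump_lt a b n1).
  rewrite -[0 <= hump_inv _ _ _ _]bm -[hump_inv _ _ _ _ <= 1]bm hump_invK//.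
  by rewrite (proj1 (fixed 0))// (proj2 (fixed 1)).
have [h hE] := homeo01_of_real (@hump_continuous R a b N)
  (@hump_inv_continuous R a b N) (humpK a b n1) (hump_invK a b n1) b01 bi01.
exists h; split.
- apply: (thompson_hump _ _ _ a0 d0 b1 erefl hE).
  + by have := Zk 0; rewrite mul0r addr0.
  + by have := Zk 1; rewrite mul1r.
  + by have := Zk n.+1; rewrite -natr1.
- move=> /(congr1 val); rewrite hE => bx.
  have axb : a < val x < b by apply/andP; split; lra.
  by have := hump_gt n1 axb; rewrite bx ltxx.
- move=> z nAz; apply: val_inj; rewrite hE.
  have [za|az] := leP (val z) a; first exact: hump_le_left.
  have [bz|zb] := leP b (val z); first exact: hump_ge_right.
  by case: nAz; apply: eA; rewrite ltr_distl; apply/andP; split; lra.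
Qed.

End ThompsonBump.

(** * Words and the Zariski topology *)

Section ZariskiWords.
Context (G : groupType).

Lemma zariski_word_open (l : nat) (g : nat -> G) (k : nat -> int) :
  open [set x : zariski G | 1%g <> word_value l g k x].
Proof.
set W := [set x | _]; exists [set W]; last by rewrite bigcup_set1.
move=> _ ->; exists [fset W]%fset; last by rewrite set_fset1 bigcap_set1.
by move=> V; rewrite in_fset1 => /eqP ->; apply/mem_set; exists l, g, k.
Qed.

(** The equation is that of the word [x g x^-1 h x g^-1 x^-1 h^-1]. *)
Lemma zariski_commutator_open (g h : G) :
  open [set x : zariski G | (x * g * x^-1) * h <> h * (x * g * x^-1)]%g.
Proof.
pose c i := nth 1%g [:: 1; g; h; g^-1; h^-1]%g i.
pose k i := nth 0 [:: 1; -1; 1; -1]%Z i.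
have wordE (x : G) : word_value 4 c k x =
    ((x * g * x^-1) * h * (h * (x * g * x^-1))^-1)%g.
  rewrite /word_value !big_ord_recl big_ord0 /= !expg1 !invgM !invgK.
  by rewrite mul1g mulg1 !mulgA.
have := zariski_word_open 4 c k.
congr (open _); apply/seteqP; split=> x /=; apply: contra_not; rewrite wordE.
  by move=> ->; rewrite mulgV.
by move=> eq1; apply: (mulIg (h * (x * g * x^-1))^-1%g); rewrite -eq1 mulgV.
Qed.

Lemma continuous_into_zariski (T : topologicalType) (u : T -> zariski G) :
  (forall l g k, open [set t | 1%g <> word_value l g k (u t)]) -> continuous u.
Proof.
move=> wopen; apply/continuousP => _ [D Dsub <-].
rewrite preimage_bigcup; apply: bigcup_open => V /Dsub [F Fsub <-].
rewrite preimage_bigcap openE => t Ft; apply: filter_bigI => W WF.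
apply: open_nbhs_nbhs; split; last exact: Ft.
by have /Fsub /set_mem[l [g [k ->]]] := WF; exact: wopen.
Qed.

End ZariskiWords.

Section WordsInHomeo.
Context (X : topologicalType) (G : groupClosed (homeo X)).
Hypotheses (hX : hausdorff_space X) (cX : compact [set: X]).
Context (T : topologicalType) (u : T -> subgroup G).
Hypothesis uc : jointly_continuous (fun t => val (u t)).

Lemma expgz_jointly_continuous (k : int) :
  jointly_continuous (fun t => val (expgz (u t) k)).
Proof.
have expc m : jointly_continuous (fun t => val (u t ^+ m)%g).
  elim: m => [|m IHm].
    rewrite (_ : (fun t => _) = fun=> 1%g); first exact: jointly_continuous_cst.
    by apply/funext => t; rewrite expg0.
  rewrite (_ : (fun t => _) = (fun t => val (u t) * val (u t ^+ m)%g)%g).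
    exact: jointly_continuousM.
  by apply/funext => t; rewrite expgS.
case: k => m; first exact: expc.
exact: (jointly_continuousV hX cX (expc m.+1)).
Qed.

Lemma word_jointly_continuous l g k :
  jointly_continuous (fun t => val (word_value l g k (u t))).
Proof.
have prodc : jointly_continuous
    (fun t => val (\prod_(i < l) (g i * expgz (u t) (k i)))%g).
  elim: l => [|l IHl].
    rewrite (_ : (fun t => _) = fun=> 1%g); first exact: jointly_continuous_cst.
    by apply/funext => t; rewrite big_ord0.
  rewrite (_ : (fun t => _) =
    (fun t => val (\prod_(i < l) (g i * expgz (u t) (k i)))%g *
      (val (g l) * val (expgz (u t) (k l))))%g).
    apply: jointly_continuousM => //; apply: jointly_continuousM.
      exact: jointly_continuous_cst.
    exact: expgz_jointly_continuous.
  by apply/funext => t; rewrite big_ord_recr.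
apply: (jointly_continuousM prodc); exact: jointly_continuous_cst.
Qed.

Lemma word_neq1_open l g k : open [set t | 1%g <> word_value l g k (u t)].
Proof.
rewrite (_ : [set _ | _] =
    [set t | (1%g : homeo X) <> val (word_value l g k (u t))]).
  apply: jointly_continuous_neq_open => //.
  exact: (@word_jointly_continuous l g k).
apply/seteqP; split=> t /=; apply: contra_not.
  by move=> e; apply: val_inj.
exact: (congr1 val).
Qed.

End WordsInHomeo.

(** * The Zariski topology sees which open sets a graph meets *)

Section Supports.
Context (X : topologicalType).
Implicit Types (f g h : homeo X) (A B : set X).

Lemma disjoint_supports_commute g h A B :
    (forall z, ~ A z -> g z = z) -> (forall z, ~ B z -> h z = z) ->
    (forall z, A z -> ~ B z) ->
  (g * h = h * g)%g.
Proof.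
have stable (u : homeo X) (C : set X) z :
    (forall z, ~ C z -> u z = z) -> C z -> C (u z).
  move=> uC Cz; apply: contrapT => nC.
  by have /(can_inj (homeo_funK u)) e := uC _ nC; rewrite e in nC.
move=> gA hB AB; apply: homeoP => z /=.
have [Az|nAz] := pselect (A z).
  by rewrite (hB z (AB z Az)) hB//; apply: AB; exact: stable.
rewrite (gA z nAz) gA// => Ahz; apply: (AB _ Ahz).
have [/(stable h B)//|/hB hz] := pselect (B z); first by apply.
by rewrite hz in Ahz.
Qed.

Lemma conjugate_support f g A : (forall z, ~ A z -> g z = z) ->
  forall z, ~ A (homeo_inv f z) -> (f * g * f^-1)%g z = z.
Proof. by move=> gA z nA /=; rewrite gA// homeo_invK. Qed.

End Supports.

Section ZariskiHitting.
Context (R : realType) (n : nat) (n_ge2 : (2 <= n)%N)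
  (G : groupClosed (homeo (I01 R)))
  (FnG : forall f : homeo (I01 R), thompson n f -> f \in G).
Local Notation I := (I01 R).

(** If [f x] lies in [B], first choose [h] supported in [B] that moves [f x],
    then [g] moving [x] and supported in [A] away from the preimage of
    [h (f x)].  Then [f g f^-1] fixes [h (f x)] but moves [f x], so it does not
    commute with [h].  Any other [s] for which [s g s^-1] and [h] do not commute
    must send some point of [A] into [B], since otherwise their supports
    would be disjoint. *)
Lemma zariski_locally_hitting (t : zariski (subgroup G)) :
  locally_hitting (fun s : zariski (subgroup G) => val (s : subgroup G)) t.
Proof.
move=> x0 A B x0A fx0B; set f := val _ in fx0B.
have /exists_interior_near[x [Ax Bfx] x01] : nbhs x0 (A° `&` f @^-1` B°).
  apply: (@filterI _ (nbhs x0) (nbhs_filter x0)); first exact: nbhs_interior.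
  exact: (@homeo_fun_continuous _ f x0) (nbhs_interior fx0B).
have [h [hF hfx hB]] :=
  exists_thompson_supported n_ge2 (homeo01_interior f x01) Bfx.
have Ax' : nbhs x (A `&` [set z | f z <> h (f x)]).
  apply: (@filterI _ (nbhs x) (nbhs_filter x)).
    by move: Ax; rewrite /= /interior.
  apply: (@homeo_fun_continuous _ f x (~` [set h (f x)])).
  apply: open_nbhs_nbhs; split; last by move=> /= /esym.
  apply: closed_openC; apply: accessible_closed_set1.
  exact/hausdorff_accessible/hausdorff01.
have [g [gF gx gA]] := exists_thompson_supported n_ge2 x01 Ax'.
pose g' : subgroup G := exist _ g (FnG gF).
pose h' : subgroup G := exist _ h (FnG hF).
apply: filterS (open_nbhs_nbhs (conj (zariski_commutator_open g' h') _)).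
  move=> s /= ncomm; apply: contrapT => nhit; apply: ncomm; apply: val_inj.
  apply: (disjoint_supports_commute (conjugate_support (f := val s) gA) hB).
  move=> z [Az _] Bz; apply: nhit; exists (homeo_inv (val s) z) => //.
  by rewrite homeo_invK.
move=> /(congr1 val)/(congr1 (fun u : homeo I => u (f x))) /= e.
have fix_hfx : g (homeo_inv f (h (f x))) = homeo_inv f (h (f x)).
  by apply: gA => -[_] /=; rewrite homeo_invK.
move: e; rewrite -/f fix_hfx homeo_invK homeo_funK => e.
by move: e => /(can_inj (homeo_funK h))/(can_inj (homeo_funK f))/esym.
Qed.

Lemma zariski_jointly_continuous :
  jointly_continuous (fun s : zariski (subgroup G) => val (s : subgroup G)).
Proof.
move=> [t p].
exact: (locally_hitting_continuous (zariski_locally_hitting (t := t))).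
Qed.

End ZariskiHitting.

(** * Comparison of the two topologies *)

Theorem theorem2p1 (R : realType) (n : nat) (n_ge2 : (2 <= n)%N)
    (G : groupClosed (homeo (I01 R)))
    (FnG : forall f : homeo (I01 R), thompson n f -> f \in G) :
  (@open (zariski (subgroup G)) =
     @open (compact_open_subgroup G) :> set_system (subgroup G)) /\
  hausdorff_space (zariski (subgroup G)) /\
  group_topology (zariski (subgroup G)).
Proof.
have hI := @hausdorff01 R; have cI := @compact01 R.
have zc := zariski_jointly_continuous n_ge2 FnG.
have cc : jointly_continuous
    (fun s : compact_open_subgroup G => val (s : subgroup G)).
  have valc := @initial_continuous _ _ (val : subgroup G -> homeo (I01 R)).
  exact: (jointly_continuous_comp valc (homeo_jointly_continuous hI cI)).
have zariskiE : @open (zariski (subgroup G)) =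
    @open (compact_open_subgroup G) :> set_system (subgroup G).
  apply/seteqP; split=> [U oU|_ [V oV <-]].
    have idc :
        continuous (id : compact_open_subgroup G -> zariski (subgroup G)).
      apply: continuous_into_zariski => l g k.
      exact: (word_neq1_open hI cI cc).
    by have /continuousP := idc; apply.
  have /continuousP := jointly_continuous_continuous zc; exact.
(* With the topologies identified, joint continuity gives continuity into
   the Zariski topology. *)
have into_zariski (T : topologicalType) (u : T -> zariski (subgroup G)) :
    jointly_continuous (fun t => val (u t : subgroup G)) -> continuous u.
  move=> uc; apply/continuousP => U; rewrite zariskiE => -[V oV <-].
  have /continuousP := jointly_continuous_continuous uc; exact.
split=> //; split.
  by apply: (jointly_continuous_inj_hausdorff hI _ zc); exact: val_inj.
have fstc : jointly_continuous
    (fun p : zariski (subgroup G) * zariski (subgroup G) =>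
      val (p.1 : subgroup G)).
  exact: (jointly_continuous_comp (fun p => cvg_fst) zc).
have sndc : jointly_continuous
    (fun p : zariski (subgroup G) * zariski (subgroup G) =>
      val (p.2 : subgroup G)).
  exact: (jointly_continuous_comp (fun p => cvg_snd) zc).
split; apply: into_zariski; first exact: (jointly_continuousM fstc sndc).
exact: (jointly_continuousV hI cI zc).
Qed.
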